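(* For every natural number $n\ge 1$, $$\frac{1}{2n+\frac{1}{1-\gamma}-2}\le \sum_{i=1}^n\frac{1}{i}-\ln n-\gamma<\frac{1}{2n+\frac13}.$$ The constants $\frac{1}{1-\gamma}-2$ and $\frac13$ are the best possible, in the following sense. (i) If $a$ is a real number with $2n+a\neq 0$ for all integers $n\ge 1$ and $\frac{1}{2n+a}\le \sum_{i=1}^n\frac1i-\ln n-\gamma$ for all integers $n\ge 1$, then $a\ge \frac{1}{1-\gamma}-2$. (ii) If $b$ is a real number with $2n+b\neq 0$ for all integers $n\ge 1$ and $\sum_{i=1}^n\frac1i-\ln n-\gamma<\frac{1}{2n+b}$ for all integers $n\ge 1$, then $b\le\frac13$.
   Context: $\gamma=\lim_{n\to\infty}\left(\sum_{i=1}^n\frac1i-\ln n\right)=0.57721566490153286\ldots$ denotes Euler's constant, and $\ln$ is the natural logarithm. *)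

(* Defs.v *)
From Stdlib Require Import Reals Lra Lia.
From Coquelicot Require Import Coquelicot.
Open Scope R_scope.

Definition harmonic_number (n : nat) : R := sum_n_m (fun i : nat => 1 / INR i) 1 n.

(* [Lim_seq] is total with values in [Rbar]; [is_lim_seq_euler_gamma] shows
   that the limit exists and is finite, so the projection to [R] loses nothing. *)
Definition euler_gamma : R :=
  real (Lim_seq (fun n : nat => harmonic_number n - ln (INR n))).

Lemma harmonic_number_S (n : nat) :
  harmonic_number (S n) = harmonic_number n + 1 / INR (S n).
Proof.
unfold harmonic_number.
rewrite sum_n_Sm; [reflexivity | lia].
Qed.

Lemma ln_le_sub_1 (x : R) : 0 < x -> ln x <= x - 1.
Proof.
intros Hx.
pose proof (exp_ineq1_le (ln x)) as H.
rewrite exp_ln in H; lra.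
Qed.

Lemma ln_INR_S_le (n : nat) : ln (INR (S n)) <= harmonic_number n.
Proof.
induction n as [|n IH].
- unfold harmonic_number; rewrite sum_n_m_zero by lia.
  change (ln 1 <= 0); rewrite ln_1; lra.
- rewrite harmonic_number_S.
  assert (Hn : 0 < INR (S n)) by (apply lt_0_INR; lia).
  rewrite (S_INR (S n)).
  replace (INR (S n) + 1) with (INR (S n) * (1 + 1 / INR (S n))) by (field; lra).
  assert (Hi : 0 < 1 / INR (S n)) by (apply Rdiv_lt_0_compat; lra).
  rewrite ln_mult by lra.
  pose proof (ln_le_sub_1 (1 + 1 / INR (S n)) ltac:(lra)); lra.
Qed.

Lemma is_lim_seq_euler_gamma :
  is_lim_seq (fun n : nat => harmonic_number n - ln (INR n)) euler_gamma.
Proof.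
apply Lim_seq_correct'.
enough (H : ex_finite_lim_seq
  (fun n : nat => harmonic_number (S n) - ln (INR (S n)))).
{ destruct H as [l Hl]; exists l; now apply is_lim_seq_incr_1. }
apply ex_finite_lim_seq_decr with 0; intros n.
- rewrite (harmonic_number_S (S n)).
  assert (Hn : 0 < INR (S n)) by (apply lt_0_INR; lia).
  assert (HS : INR (S (S n)) = INR (S n) + 1) by apply S_INR.
  pose proof (ln_le_sub_1 (INR (S n) / INR (S (S n)))
    ltac:(apply Rdiv_lt_0_compat; lra)) as H.
  rewrite ln_div in H by lra.
  replace (INR (S n) / INR (S (S n)) - 1) with (- (1 / INR (S (S n)))) in H
    by (rewrite HS; field; lra).
  lra.
- pose proof (ln_INR_S_le n) as H.
  rewrite harmonic_number_S.
  assert (Hn : 0 < INR (S n)) by (apply lt_0_INR; lia).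
  assert (Hi : 0 < 1 / INR (S n)) by (apply Rdiv_lt_0_compat; lra).
  lra.
Qed.

(* Main.v *)
Require Import Defs.
From Stdlib Require Import Reals Lra Lia.
From Coquelicot Require Import Coquelicot.
Open Scope R_scope.

(** Write D(n) for the error H(n) - ln n - gamma.  The expansion
    D(n) = 1/(2n) - 1/(12 n^2) + 1/(120 n^4) - ... gives
    1/D(n) - 2n = 1/3 + 1/(18n) - (13/540)/n^2 + ..., which suggests both
    constants: 1/3 is the limit of 1/D(n) - 2n, approached from above, and
    1/(1 - gamma) - 2 is the value of 1/D(n) - 2n at n = 1, where it is largest.

    To turn this into a proof, D(n) is squeezed strictly between
    lower_approx n = 1/(2n + 1/3 + 1/(18n)) and upper_approx n = 1/(2n + 1/3).
    All three sequences tend to 0, so it suffices to compare their decrements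
    (neg_of_increasing_to_0).  The decrement of D is ln(1 + 1/n) - 1/(n+1),
    and with y = 1/(2n+1) one has ln(1 + 1/n) = ln((1+y)/(1-y)); bounding this
    by the odd power series cut at order five (artanh_lower, artanh_upper)
    reduces each comparison to the positivity of a rational function of n.

    The upper bound of the theorem is then D(n) < upper_approx n.  The lower
    bound is an equality at n = 1; for n >= 2 it follows from
    lower_approx n < D(n), since 1/3 + 1/(18n) <= 1/3 + 1/36 lies below
    1/(1 - gamma) - 2.  The margin in the latter comparison is small and calls
    for a numerical bound on gamma (euler_gamma_lower).  The constant 1/3 cannot
    be increased since 1/(18n) tends to 0, and 1/(1 - gamma) - 2 cannot be
    decreased because of n = 1. *)

(** * Bounds on ln((1+y)/(1-y)) *)

Lemma le_of_is_derive_nonneg (f f' : R -> R) (a b : R) :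
  a <= b ->
  (forall t, a <= t <= b -> is_derive f t (f' t)) ->
  (forall t, a <= t <= b -> 0 <= f' t) ->
  f a <= f b.
Proof.
intros Hab Hd Hpos.
destruct (MVT_gen f a b f') as [c [Hc Heq]];
  rewrite ?Rmin_left, ?Rmax_right in * by lra.
- intros t Ht; apply Hd; lra.
- intros t Ht; apply derivable_continuous_pt, ex_derive_Reals_0.
  exists (f' t); apply Hd; lra.
- pose proof (Rmult_le_pos (f' c) (b - a) (Hpos c Hc) ltac:(lra)); lra.
Qed.

Lemma artanh_lower (y : R) : 0 <= y < 1 ->
  2 * (y + y ^ 3 / 3 + y ^ 5 / 5) <= ln (1 + y) - ln (1 - y).
Proof.
intros Hy.
pose proof (le_of_is_derive_nonneg
  (fun t => ln (1 + t) - ln (1 - t) - 2 * (t + t ^ 3 / 3 + t ^ 5 / 5))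
  (fun t => 2 * t ^ 6 / ((1 + t) * (1 - t))) 0 y) as H.
cbv beta in H.
rewrite Rplus_0_r, Rminus_0_r, ln_1 in H.
enough (0 - 0 - 2 * (0 + 0 ^ 3 / 3 + 0 ^ 5 / 5) <=
  ln (1 + y) - ln (1 - y) - 2 * (y + y ^ 3 / 3 + y ^ 5 / 5)) by lra.
apply H; [lra | |].
- intros t Ht; auto_derive; [lra | simpl; field; lra].
- intros t Ht; apply Rdiv_le_0_compat.
  + pose proof (pow_le t 6 ltac:(lra)); lra.
  + apply Rmult_lt_0_compat; lra.
Qed.

(** The remainder y^5/5 + y^7/7 + ... of the series is at most the geometric
    series (y^5/5) (1 + y^2 + y^4 + ...). *)
Lemma artanh_upper (y : R) : 0 <= y < 1 ->
  ln (1 + y) - ln (1 - y) <= 2 * (y + y ^ 3 / 3 + y ^ 5 / (5 * (1 - y ^ 2))).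
Proof.
intros Hy.
pose proof (le_of_is_derive_nonneg
  (fun t => 2 * (t + t ^ 3 / 3 + t ^ 5 / (5 * (1 - t ^ 2)))
            - (ln (1 + t) - ln (1 - t)))
  (fun t => 4 * t ^ 6 / (5 * ((1 + t) * (1 - t)) ^ 2)) 0 y) as H.
cbv beta in H.
rewrite Rplus_0_r, Rminus_0_r, ln_1 in H.
enough (2 * (0 + 0 ^ 3 / 3 + 0 ^ 5 / (5 * (1 - 0 ^ 2))) - (0 - 0) <=
  2 * (y + y ^ 3 / 3 + y ^ 5 / (5 * (1 - y ^ 2)))
  - (ln (1 + y) - ln (1 - y))) by lra.
apply H; [lra | |].
- intros t Ht.
  assert (0 < (1 + t) * (1 - t)) by (apply Rmult_lt_0_compat; lra).
  auto_derive; [repeat split; simpl; lra | field; repeat split; lra].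
- intros t Ht; apply Rdiv_le_0_compat.
  + pose proof (pow_le t 6 ltac:(lra)); lra.
  + apply Rmult_lt_0_compat; [lra |].
    apply pow_lt, Rmult_lt_0_compat; lra.
Qed.

(** The substitution y = 1/(2x+1) centres the interval [x, x+1] at its midpoint,
    which kills the even-order terms and makes the truncated series precise
    enough already at x = 1. *)
Lemma ln_succ_sub_ln (x : R) : 0 < x ->
  ln (x + 1) - ln x = ln (1 + 1 / (2 * x + 1)) - ln (1 - 1 / (2 * x + 1)).
Proof.
intros Hx.
replace (1 + 1 / (2 * x + 1)) with ((x + 1) * (2 / (2 * x + 1))) by (field; lra).
replace (1 - 1 / (2 * x + 1)) with (x * (2 / (2 * x + 1))) by (field; lra).
assert (0 < 2 / (2 * x + 1)) by (apply Rdiv_lt_0_compat; lra).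
rewrite !ln_mult by lra; ring.
Qed.

Lemma inv_2x1_bounds (x : R) : 0 < x -> 0 <= 1 / (2 * x + 1) < 1.
Proof.
intros Hx; split.
- apply Rdiv_le_0_compat; lra.
- apply Rlt_div_l; lra.
Qed.

(** * Comparison of decrements *)

Definition upper_approx (x : R) : R := 1 / (2 * x + 1 / 3).
(** The denominator is the expansion of 1/D(x), D being the error of the
    harmonic sum, up to order 1/x; the next term, of order 1/x^2, is negative,
    which makes this a lower bound. *)
Definition lower_approx (x : R) : R := 1 / (2 * x + 1 / 3 + 1 / (18 * x)).

Lemma ln_step_lt_upper_approx (x : R) : 1 <= x ->
  ln (x + 1) - ln x - 1 / (x + 1) < upper_approx x - upper_approx (x + 1).
Proof.
intros Hx.
rewrite ln_succ_sub_ln by lra.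
pose proof (artanh_upper (1 / (2 * x + 1)) (inv_2x1_bounds x ltac:(lra))) as H.
eapply Rle_lt_trans; [apply Rplus_le_compat_r, H |].
apply Rminus_lt_0.
(* In terms of m = x - 1 >= 0, the numerator of the difference has only
   positive coefficients. *)
assert (Hm : exists m, 0 <= m /\ x = m + 1) by (exists (x - 1); lra).
destruct Hm as [m [Hm ->]]; clear H Hx.
unfold upper_approx.
match goal with |- 0 < ?e =>
  replace e with
    ((360 * m ^ 3 + 1372 * m ^ 2 + 1710 * m + 677)
     / (30 * (m + 1) * (m + 2) * (2 * m + 3) ^ 3 * (6 * m + 7) * (6 * m + 13)))
end.
- apply Rdiv_lt_0_compat.
  + pose proof (pow_le m 2 Hm); pose proof (pow_le m 3 Hm); lra.
  + repeat apply Rmult_lt_0_compat; try apply pow_lt; lra.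
- field; repeat split; try lra.
  assert (0 <= m * m) by (apply Rmult_le_pos; lra). nra.
Qed.

Lemma lower_approx_lt_ln_step (x : R) : 1 <= x ->
  lower_approx x - lower_approx (x + 1) < ln (x + 1) - ln x - 1 / (x + 1).
Proof.
intros Hx.
rewrite ln_succ_sub_ln by lra.
pose proof (artanh_lower (1 / (2 * x + 1)) (inv_2x1_bounds x ltac:(lra))) as H.
eapply Rlt_le_trans; [| apply Rplus_le_compat_r, H].
apply Rminus_lt_0.
(* As for the upper approximation, the shift by 1 makes every coefficient of
   the numerator positive. *)
assert (Hm : exists m, 0 <= m /\ x = m + 1) by (exists (x - 1); lra).
destruct Hm as [m [Hm ->]]; clear H Hx.
unfold lower_approx.
match goal with |- 0 < ?e =>
  replace e with
    ((14976 * m ^ 5 + 126000 * m ^ 4 + 418816 * m ^ 3 + 688736 * m ^ 2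
      + 561378 * m + 182037)
     / (15 * (m + 2) * (2 * m + 3) ^ 5 * (36 * (m + 1) ^ 2 + 6 * (m + 1) + 1)
        * (36 * (m + 2) ^ 2 + 6 * (m + 2) + 1)))
end.
- apply Rdiv_lt_0_compat.
  + pose proof (pow_le m 2 Hm); pose proof (pow_le m 3 Hm).
    pose proof (pow_le m 4 Hm); pose proof (pow_le m 5 Hm); lra.
  + pose proof (pow_le (m + 1) 2 ltac:(lra)).
    pose proof (pow_le (m + 2) 2 ltac:(lra)).
    repeat apply Rmult_lt_0_compat; try apply pow_lt; lra.
- field; repeat split; nra.
Qed.

(** * The error of the harmonic sum *)

Lemma lim_0_of_le_inv (f : R -> R) :
  (forall x, 1 <= x -> 0 <= f x <= 1 / x) ->
  is_lim_seq (fun n => f (INR n)) 0.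
Proof.
intros Hf.
apply is_lim_seq_le_le_loc with (u := fun _ => 0) (w := fun n => / INR n).
- exists 1%nat; intros n Hn.
  pose proof (Hf (INR n) ltac:(apply (le_INR 1); lia)); lra.
- apply is_lim_seq_const.
- apply (is_lim_seq_inv INR p_infty is_lim_seq_INR); discriminate.
Qed.

Lemma upper_approx_lim : is_lim_seq (fun n => upper_approx (INR n)) 0.
Proof.
apply lim_0_of_le_inv; intros x Hx; unfold upper_approx; split.
- apply Rdiv_le_0_compat; lra.
- apply Rmult_le_compat_l; [lra |]; apply Rinv_le_contravar; lra.
Qed.

Lemma lower_approx_lim : is_lim_seq (fun n => lower_approx (INR n)) 0.
Proof.
apply lim_0_of_le_inv; intros x Hx; unfold lower_approx.
assert (0 < 1 / (18 * x)) by (apply Rdiv_lt_0_compat; lra).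
split.
- apply Rdiv_le_0_compat; lra.
- apply Rmult_le_compat_l; [lra |]; apply Rinv_le_contravar; lra.
Qed.

Definition harmonic_error (n : nat) : R :=
  harmonic_number n - ln (INR n) - euler_gamma.

Lemma harmonic_error_lim : is_lim_seq harmonic_error 0.
Proof.
replace (Finite 0) with (Finite (euler_gamma - euler_gamma)) by (f_equal; ring).
apply is_lim_seq_minus'; [apply is_lim_seq_euler_gamma | apply is_lim_seq_const].
Qed.

Lemma harmonic_error_step (n : nat) :
  harmonic_error n - harmonic_error (S n)
  = ln (INR n + 1) - ln (INR n) - 1 / (INR n + 1).
Proof.
unfold harmonic_error; rewrite harmonic_number_S, S_INR; ring.
Qed.

(** Inequalities between decrements of two null sequences transfer to the
    sequences themselves by applying this to their difference. *)
Lemma neg_of_increasing_to_0 (u : nat -> R) :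
  (forall n, (1 <= n)%nat -> u n < u (S n)) -> is_lim_seq u 0 ->
  forall n, (1 <= n)%nat -> u n < 0.
Proof.
intros Hinc Hlim n Hn.
apply Rlt_le_trans with (u (S n)); [now apply Hinc |].
apply (is_lim_seq_incr_compare (fun k => u (S k)) 0).
- now apply is_lim_seq_incr_1 in Hlim.
- intros k; apply Rlt_le, Hinc; lia.
Qed.

Lemma harmonic_error_lt_upper_approx (n : nat) : (1 <= n)%nat ->
  harmonic_error n < upper_approx (INR n).
Proof.
intros Hn; apply Rminus_lt.
apply (neg_of_increasing_to_0
  (fun k => harmonic_error k - upper_approx (INR k))); [| | exact Hn].
- intros k Hk.
  pose proof (harmonic_error_step k).
  pose proof (ln_step_lt_upper_approx (INR k) ltac:(apply (le_INR 1); lia)).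
  rewrite S_INR; lra.
- replace (Finite 0) with (Finite (0 - 0)) by (f_equal; ring).
  apply is_lim_seq_minus'; [apply harmonic_error_lim | apply upper_approx_lim].
Qed.

Lemma lower_approx_lt_harmonic_error (n : nat) : (1 <= n)%nat ->
  lower_approx (INR n) < harmonic_error n.
Proof.
intros Hn; apply Rminus_lt.
apply (neg_of_increasing_to_0
  (fun k => lower_approx (INR k) - harmonic_error k)); [| | exact Hn].
- intros k Hk.
  pose proof (harmonic_error_step k).
  pose proof (lower_approx_lt_ln_step (INR k) ltac:(apply (le_INR 1); lia)).
  rewrite S_INR; lra.
- replace (Finite 0) with (Finite (0 - 0)) by (f_equal; ring).
  apply is_lim_seq_minus'; [apply lower_approx_lim | apply harmonic_error_lim].
Qed.

Lemma harmonic_error_1 : harmonic_error 1 = 1 - euler_gamma.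
Proof.
unfold harmonic_error, harmonic_number.
rewrite sum_n_n; change (INR 1) with 1; rewrite ln_1; field.
Qed.

(** * The lower bound and the optimality of the constants *)

Lemma ln_2_upper : ln 2 <= 0.69322.
Proof.
pose proof (artanh_upper (1 / 3) ltac:(lra)) as H.
replace 2 with ((1 + 1 / 3) / (1 - 1 / 3)) by field.
rewrite ln_div by lra; lra.
Qed.

(** The comparison of 1/(1 - gamma) - 2 with 1/3 + 1/36 needs gamma >= 49/85 = 0.57647...
    The bound gamma > H(n) - ln n - 1/(2n + 1/3) falls short of it for n = 1
    and n = 2; n = 4 suffices, and involves no other logarithm than ln 2. *)
Lemma euler_gamma_lower : 0.5765 < euler_gamma.
Proof.
pose proof (harmonic_error_lt_upper_approx 4 ltac:(lia)) as H.
unfold harmonic_error, upper_approx in H.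
rewrite 3!harmonic_number_S in H.
unfold harmonic_number in H; rewrite sum_n_n in H.
replace (INR 4) with (2 * 2) in H by (simpl; ring).
rewrite ln_mult in H by lra.
simpl in H; pose proof ln_2_upper; lra.
Qed.

Lemma inv_le_harmonic_error (n : nat) : (1 <= n)%nat ->
  1 / (2 * INR n + 1 / (1 - euler_gamma) - 2) <= harmonic_error n.
Proof.
intros Hn.
assert (Hg : euler_gamma < 1).
{ pose proof (lower_approx_lt_harmonic_error 1 ltac:(lia)) as H.
  rewrite harmonic_error_1 in H; unfold lower_approx in H; simpl in H; lra. }
destruct (Nat.eq_dec n 1) as [-> | Hn1].
- rewrite harmonic_error_1; simpl INR; apply Req_le; field; lra.
- assert (Hx : 2 <= INR n) by (apply (le_INR 2); lia).
  apply Rle_trans with (lower_approx (INR n));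
    [| now apply Rlt_le, lower_approx_lt_harmonic_error].
  pose proof euler_gamma_lower.
  (* 2.3612 exceeds 2 + 1/3 + 1/36 = 2.36111..., and 1 / (1 - 0.5765) exceeds
     2.3612. *)
  assert (2.3612 < 1 / (1 - euler_gamma)) by (apply -> Rlt_div_r; lra).
  assert (0 < 1 / (18 * INR n)) by (apply Rdiv_lt_0_compat; lra).
  assert (1 / (18 * INR n) <= 1 / 36)
    by (apply Rmult_le_compat_l; [| apply Rinv_le_contravar]; lra).
  apply Rmult_le_compat_l; [| apply Rinv_le_contravar]; lra.
Qed.

Lemma inv_lt_half_pos (t : R) : 1 / t < 1 / 2 -> 0 < t -> 2 < t.
Proof.
intros H Ht; apply Rnot_le_lt; intros Hle.
pose proof (Rinv_le_contravar t 2 Ht Hle); lra.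
Qed.

(** The case n = 1 gives the claim as soon as 2 + a > 0.  Otherwise 2n + a would
    have to become positive at some n; since its increments are 2, its first
    positive value is at most 2, and then 1/(2n + a) >= 1/2 > D(n). *)
Lemma lower_constant_optimal (a : R) :
  (forall n : nat, (1 <= n)%nat -> 1 / (2 * INR n + a) <= harmonic_error n) ->
  a >= 1 / (1 - euler_gamma) - 2.
Proof.
intros Hle.
assert (Hsmall : forall n, (1 <= n)%nat -> 0 < 2 * INR n + a -> 2 < 2 * INR n + a).
{ intros n Hn; apply inv_lt_half_pos.
  pose proof (le_INR 1 n Hn) as Hx; simpl in Hx.
  pose proof (Hle n Hn); pose proof (harmonic_error_lt_upper_approx n Hn).
  unfold upper_approx in *.
  pose proof (Rinv_lt_contravar 2 (2 * INR n + 1 / 3) ltac:(lra) ltac:(lra)).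
  lra. }
assert (Ha : 0 < 2 + a).
{ destruct (Rlt_or_le 0 (2 + a)) as [| Hneg]; [assumption | exfalso].
  assert (Hall : forall n, 2 * INR (S n) + a <= 0).
  { induction n as [| n IH]; [simpl; lra |].
    apply Rnot_lt_le; intros Hlt.
    pose proof (Hsmall (S (S n)) ltac:(lia) Hlt) as H.
    rewrite S_INR in H; lra. }
  destruct (INR_unbounded (- a)) as [N HN].
  pose proof (Hall N) as H; rewrite S_INR in H; pose proof (pos_INR N); lra. }
pose proof (Hle 1%nat ltac:(lia)) as H1.
rewrite harmonic_error_1 in H1; simpl INR in H1.
assert (0 < 1 / (2 * 1 + a)) by (apply Rdiv_lt_0_compat; lra).
enough (1 / (1 - euler_gamma) <= 2 * 1 + a) by lra.
apply Rle_div_l; [lra |]; apply Rle_div_l in H1; lra.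
Qed.

(** If b > 1/3, then 1/3 + 1/(18n) < b for large n, and lower_approx n exceeds
    the alleged upper bound. *)
Lemma upper_constant_optimal (b : R) :
  (forall n : nat, (1 <= n)%nat -> harmonic_error n < 1 / (2 * INR n + b)) ->
  b <= 1 / 3.
Proof.
intros Hlt; apply Rnot_lt_le; intros Hb.
destruct (INR_unbounded (1 / (b - 1 / 3))) as [N HN].
assert (0 < 1 / (b - 1 / 3)) by (apply Rdiv_lt_0_compat; lra).
assert (HN0 : (1 <= N)%nat) by (apply INR_lt; simpl; lra).
apply (Rlt_irrefl (harmonic_error N)).
apply Rlt_trans with (1 / (2 * INR N + b)); [now apply Hlt |].
apply Rle_lt_trans with (lower_approx (INR N));
  [| now apply lower_approx_lt_harmonic_error].
assert (0 < 1 / (18 * INR N)) by (apply Rdiv_lt_0_compat; lra).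
enough (1 / (18 * INR N) <= b - 1 / 3)
  by (apply Rmult_le_compat_l; [| apply Rinv_le_contravar]; lra).
apply Rle_div_l; [lra |].
apply Rlt_gt, Rlt_div_l in HN; lra.
Qed.

Theorem theorem1 :
  (forall n : nat, (1 <= n)%nat ->
     1 / (2 * INR n + 1 / (1 - euler_gamma) - 2)
       <= harmonic_number n - ln (INR n) - euler_gamma
     /\ harmonic_number n - ln (INR n) - euler_gamma
       < 1 / (2 * INR n + 1 / 3))
  /\
  (forall a : R,
     (forall n : nat, (1 <= n)%nat -> 2 * INR n + a <> 0) ->
     (forall n : nat, (1 <= n)%nat ->
        1 / (2 * INR n + a) <= harmonic_number n - ln (INR n) - euler_gamma) ->
     a >= 1 / (1 - euler_gamma) - 2)
  /\
  (forall b : R,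
     (forall n : nat, (1 <= n)%nat -> 2 * INR n + b <> 0) ->
     (forall n : nat, (1 <= n)%nat ->
        harmonic_number n - ln (INR n) - euler_gamma < 1 / (2 * INR n + b)) ->
     b <= 1 / 3).
Proof.
split; [| split].
- intros n Hn; split.
  + now apply inv_le_harmonic_error.
  + now apply harmonic_error_lt_upper_approx.
- intros a _; exact (lower_constant_optimal a).
- intros b _; exact (upper_constant_optimal b).
Qed.
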